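(* For all $n\geq 2$, the number $d_n(123)$ of desarrangements of length $n$ avoiding $123$ equals the Fine number $F_{n+1}$.
   Context: Permutations are in one-line notation. An index $i\in[n-1]$ is a descent of $\pi\in\mathfrak{S}_n$ if $\pi_i>\pi_{i+1}$; $i\in[n]$ is an ascent if it is not a descent (so $n$ is always an ascent). A desarrangement is a permutation whose first ascent is even. $d_n(\Pi)$ is the number of desarrangements in $\mathfrak{S}_n$ avoiding every pattern in $\Pi$ ($\pi$ avoids $\sigma$ if no subsequence of $\pi$ has the same relative order as $\sigma$). The Fine numbers $F_n$ are defined by $\sum_{n\ge0}F_nx^n=\frac{1-\sqrt{1-4x}}{3-\sqrt{1-4x}}$. *)

(* Defs.v *)
From HB Require Import structures.
From mathcomp Require Import all_boot all_order all_algebra all_fingroup.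
From mathcomp Require Import ring.

Set Implicit Arguments.
Unset Strict Implicit.
Unset Printing Implicit Defensive.

Import GRing.Theory Num.Theory.

(* A permutation s : 'S_n has one-line notation s 0, ..., s (n-1); positions
   and values are both 0-based. The indices i of descents and ascents below are
   1-based, so that their parity is the usual one. *)

(* i is a descent when positions i and i + 1 (1-based) both exist, i.e.
   i \in [n-1], and s_i > s_(i+1). *)
Definition descent (n : nat) (s : 'S_n) (i : nat) : bool :=
  [exists j : 'I_n, exists k : 'I_n, [&& j.+1 == i, k.+1 == i.+1 & s k < s j]].

Definition ascent (n : nat) (s : 'S_n) (i : nat) : bool :=
  (1 <= i <= n) && ~~ descent s i.

(* Least ascent of s, for n > 0; n itself is then an ascent. *)
Definition first_ascent (n : nat) (s : 'S_n) : nat :=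
  (find (ascent s) (iota 1 n)).+1.

Definition desarrangement (n : nat) (s : 'S_n) : bool :=
  ~~ odd (first_ascent s).

Definition contains (n k : nat) (s : 'S_n) (p : 'S_k) : bool :=
  [exists f : {ffun 'I_k -> 'I_n},
     [forall i : 'I_k, forall j : 'I_k, (i < j) ==> (f i < f j)] &&
     [forall i : 'I_k, forall j : 'I_k, (s (f i) < s (f j)) == (p i < p j)]].

Definition pattern := {k : nat & 'S_k}.

Definition avoids (n : nat) (s : 'S_n) (p : pattern) : bool :=
  ~~ contains s (tagged p).

Definition desarr_count (n : nat) (Pi : seq pattern) : nat :=
  #|[set s : 'S_n | desarrangement s && all (avoids s) Pi]|.

Definition pat123 : pattern := Tagged (fun k => 'S_k) (1%g : 'S_3).

Local Open Scope ring_scope.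

(* Formal power series over the rationals, as coefficient sequences. *)
Definition fps := nat -> rat.

Definition fps_const (c : rat) : fps := fun n => if n == 0%N then c else 0.
Definition fps_X : fps := fun n => if n == 1%N then 1 else 0.
Definition fps_sub (f g : fps) : fps := fun n => f n - g n.
Definition fps_mul (f g : fps) : fps :=
  fun n => \sum_(i < n.+1) f i * g (n - i)%N.

(* The series whose n-th coefficient is computed by step from the sequence of
   the n previous ones. *)
Fixpoint fps_rec_seq (step : seq rat -> rat) (n : nat) : seq rat :=
  if n is m.+1 then
    let s := fps_rec_seq step m in rcons s (step s)
  else [::].

Definition fps_rec (step : seq rat -> rat) : fps :=
  fun n => step (fps_rec_seq step n).

(* Multiplicative inverse of f, when f 0 != 0 (see fps_mulV). *)
Definition fps_inv (f : fps) : fps :=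
  fps_rec (fun s => let n := size s in
    (f 0%N)^-1 * ((n == 0%N)%:R - \sum_(i < n) f i.+1 * s`_(n - i.+1))).

(* Square root of f with constant term 1, when f 0 = 1 (see fps_sqrt0,
   fps_sqr_sqrt and fps_sqrt_unique). *)
Definition fps_sqrt (f : fps) : fps :=
  fps_rec (fun s => let n := size s in
    if n == 0%N then 1
    else (f n - \sum_(1 <= i < n) s`_i * s`_(n - i)) / 2%:R).

Definition fps_div (f g : fps) : fps := fps_mul f (fps_inv g).

Definition sqrt_1m4X : fps :=
  fps_sqrt (fps_sub (fps_const 1) (fps_mul (fps_const 4%:R) fps_X)).

Definition Fine : fps :=
  fps_div (fps_sub (fps_const 1) sqrt_1m4X)
          (fps_sub (fps_const 3%:R) sqrt_1m4X).

Lemma size_fps_rec_seq step n : size (fps_rec_seq step n) = n.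
Proof. by elim: n => //= n IH; rewrite size_rcons IH. Qed.

Lemma nth_fps_rec_seq step n i :
  (i < n)%N -> (fps_rec_seq step n)`_i = fps_rec step i.
Proof.
elim: n => //= n IH; rewrite ltnS leq_eqVlt nth_rcons size_fps_rec_seq.
case/predU1P => [->|lt_in]; first by rewrite ltnn eqxx.
by rewrite lt_in IH.
Qed.

Lemma fps_invE f n : fps_inv f n =
  (f 0%N)^-1 * ((n == 0%N)%:R - \sum_(i < n) f i.+1 * fps_inv f (n - i.+1)%N).
Proof.
rewrite {1}/fps_inv /fps_rec size_fps_rec_seq; congr (_ * (_ - _)).
apply: eq_bigr => i _; rewrite nth_fps_rec_seq //.
by rewrite ltn_subrL (leq_ltn_trans (leq0n i) (ltn_ord i)).
Qed.

Lemma fps_mulV f : f 0%N != 0 -> fps_mul f (fps_inv f) =1 fps_const 1.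
Proof.
move=> f0 n; rewrite /fps_mul /fps_const big_ord_recl /= subn0 fps_invE.
by rewrite mulVKf // subrK; case: (n == 0%N).
Qed.

Lemma fps_sqrtE f n : fps_sqrt f n =
  if n == 0%N then 1
  else (f n - \sum_(1 <= i < n) fps_sqrt f i * fps_sqrt f (n - i)%N) / 2%:R.
Proof.
rewrite {1}/fps_sqrt /fps_rec size_fps_rec_seq; case: eqP => // _.
congr ((_ - _) / _); apply: eq_big_nat => i /andP[i_gt0 lt_in].
by rewrite !nth_fps_rec_seq // ltn_subrL i_gt0 (leq_ltn_trans _ lt_in).
Qed.

Lemma fps_sqrt0 f : fps_sqrt f 0%N = 1.
Proof. by []. Qed.

Lemma fps_mulSE f g n : fps_mul f g n.+1 =
  f 0%N * g n.+1 + \sum_(1 <= i < n.+1) f i * g (n.+1 - i)%N + f n.+1 * g 0%N.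
Proof.
rewrite /fps_mul -(big_mkord xpredT (fun i => f i * g (n.+1 - i)%N)).
by rewrite big_nat_recr // big_ltn //= subn0 subnn.
Qed.

Lemma fps_sqr_sqrt f :
  f 0%N = 1 -> fps_mul (fps_sqrt f) (fps_sqrt f) =1 f.
Proof.
move=> f0 [|n]; first by rewrite /fps_mul big_ord1 fps_sqrt0 f0 mulr1.
rewrite fps_mulSE fps_sqrt0 (fps_sqrtE f n.+1) /=.
by set S := \sum_(_ <= _ < _) _; field.
Qed.

Lemma fps_sqrt_unique f g :
  g 0%N = 1 -> fps_mul g g =1 f -> g =1 fps_sqrt f.
Proof.
move=> g0 gg n; elim/ltn_ind: n => -[|n] IH; first by rewrite g0.
rewrite fps_sqrtE /= -gg fps_mulSE g0.
rewrite (_ : \sum_(1 <= i < n.+1) fps_sqrt f i * fps_sqrt f (n.+1 - i)%N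
           = \sum_(1 <= i < n.+1) g i * g (n.+1 - i)%N).
  by set S := \sum_(_ <= _ < _) _; field.
apply: eq_big_nat => i /andP[i_gt0 lt_in].
by rewrite !IH // ltn_subrL i_gt0.
Qed.

(* Main.v *)
(* Let r be the length of the initial decreasing run, which is the first ascent.
   Inserting a new maximum after p entries of a 123-avoiding permutation keeps it
   123-avoiding exactly when p <= r, and the new run has length r + 1 if p = 0
   and p otherwise. Hence the number B(n, k) of 123-avoiders with r = k satisfies
   B(n+1, j+1) = sum_(k >= j) B(n, k), i.e. B(n, k) = [x^n] u^k where
   u = x + u^2, so that u = (1 - sqrt (1 - 4x)) / 2. The even runs contribute
   E = 1 / (1 - u^2), and x = u (1 - u) gives x E = u / (1 + u), the generating
   series of the Fine numbers. *)
Require Import Defs.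
From mathcomp Require Import all_boot all_order all_algebra all_fingroup.
From mathcomp Require Import ring zify.

Set Implicit Arguments.
Unset Strict Implicit.
Unset Printing Implicit Defensive.

Import GRing.Theory Num.Theory.
Local Open Scope ring_scope.

Section RunStatistics.
Local Open Scope nat_scope.

(** * The initial decreasing run and the first ascent *)

Definition prefix_decreasing (n : nat) (s : 'S_n) (m : nat) : bool :=
  [forall i : 'I_n, forall j : 'I_n, (i < j < m) ==> (s j < s i)].

Lemma prefix_decreasingP (n : nat) (s : 'S_n) (m : nat) :
  reflect (forall i j : 'I_n, i < j -> j < m -> s j < s i)
          (prefix_decreasing s m).
Proof.
apply: (iffP 'forall_forallP) => [H i j ij jm|H i j].
  by move: (H i j); rewrite ij jm.
by apply/implyP => /andP[ij jm]; apply: H.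
Qed.

Lemma prefix_decreasing_le (n : nat) (s : 'S_n) (m m' : nat) :
  m' <= m -> prefix_decreasing s m -> prefix_decreasing s m'.
Proof.
move=> le_m /prefix_decreasingP H; apply/prefix_decreasingP => i j ij jm.
by apply: H => //; apply: leq_trans le_m.
Qed.

Lemma prefix_decreasing0 (n : nat) (s : 'S_n) : prefix_decreasing s 0.
Proof. by apply/prefix_decreasingP. Qed.

Definition run (n : nat) (s : 'S_n) : nat :=
  \max_(m < n.+1 | prefix_decreasing s m) m.

(** Decreasing prefixes are closed under shortening, so the longest one determines them all. The
    bound [m <= n] is separate because [prefix_decreasing s m] does not force it. *)
Lemma leq_run (n : nat) (s : 'S_n) (m : nat) :
  (m <= run s) = (m <= n) && prefix_decreasing s m.
Proof.
apply/idP/andP => [le_m|[le_mn dec]]; last first.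
  by apply: (@leq_bigmax_cond _ _ (@nat_of_ord n.+1) (Ordinal (le_mn : m < n.+1))).
have [|k dec run_k] := @eq_bigmax_cond _ [pred m : 'I_n.+1 | prefix_decreasing s m]
  (@nat_of_ord n.+1).
  by apply/card_gt0P; exists ord0; rewrite inE prefix_decreasing0.
have le_mk : m <= k by rewrite -run_k.
split; first by apply: leq_trans le_mk (leq_ord k).
exact: prefix_decreasing_le le_mk dec.
Qed.

Lemma run_le (n : nat) (s : 'S_n) : run s <= n.
Proof. by have := leq_run s (run s); rewrite leqnn => /esym/andP[]. Qed.

Lemma eq_from_leq (a b : nat) : (forall m, (m <= a) = (m <= b)) -> a = b.
Proof. by move=> H; apply/eqP; rewrite eqn_leq -H leqnn H leqnn. Qed.

Lemma descentE (n : nat) (s : 'S_n) (j k : 'I_n) :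
  k = j.+1 :> nat -> descent s j.+1 = (s k < s j).
Proof.
move=> kj; apply/existsP/idP => [[j' /existsP[k' /and3P[]]]|lt_s].
  rewrite !eqSS => /eqP ej /eqP ek.
  have -> : j' = j by apply: val_inj.
  by have -> : k' = k by apply: val_inj; rewrite /= ek kj.
by exists j; apply/existsP; exists k; rewrite kj !eqxx.
Qed.

(* For n = 0 the run has length 0, whereas [first_ascent s = 1]. *)
Lemma first_ascentE (n : nat) (s : 'S_n) : 0 < n -> first_ascent s = run s.
Proof.
move=> n_gt0; rewrite /first_ascent.
have asc_n : ascent s n.
  rewrite /ascent n_gt0 leqnn /=; apply/existsP => -[j /existsP[k /and3P[_]]].
  by rewrite eqSS => /eqP kn; have := ltn_ord k; rewrite kn ltnn.
case: (findP (ascent s) (iota 1 n)) => [/hasPn/(_ n)|f].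
  by rewrite mem_iota n_gt0 add1n ltnS leqnn asc_n => /(_ isT).
rewrite size_iota => lt_fn /(_ 0); rewrite nth_iota // add1n => asc_f desc.
have desc' j k : j < f -> k = j.+1 -> forall (hj : j < n) (hk : k < n),
   s (Ordinal hk) < s (Ordinal hj).
  move=> lt_jf -> hj hk; have := desc 0 _ lt_jf.
  rewrite nth_iota // add1n /ascent /= hj /= => /negbFE.
  by rewrite (@descentE _ s (Ordinal hj) (Ordinal hk)).
(* The [f] indices before the first ascent are descents, and [f] descents compare [f.+1] entries. *)
have dec : prefix_decreasing s f.+1.
  apply/prefix_decreasingP => -[i hi] [j hj] /=.
  elim: j hj => // j IH hj; rewrite !ltnS leq_eqVlt => /predU1P[eij|lt_ij] lt_jf.
    by apply: desc' => //; rewrite eij.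
  have hj' : j < n by apply: ltnW.
  apply: ltn_trans (IH hj' lt_ij (ltnW lt_jf)).
  exact: desc'.
apply: eq_from_leq => m; rewrite leq_run.
have [le_m|lt_m] := leqP m f.+1.
  by rewrite (leq_trans le_m lt_fn) (prefix_decreasing_le le_m dec).
apply/esym/negP => /andP[le_mn /prefix_decreasingP dec_m].
have hf : f.+1 < n by apply: leq_trans le_mn.
move: asc_f => /andP[_ /negP[]].
rewrite (@descentE _ s (Ordinal lt_fn) (Ordinal hf)) //.
exact: dec_m.
Qed.

(** * Avoidance of 123 *)

Definition increasing_triple_free (n : nat) (s : 'S_n) : Prop :=
  forall i j k : 'I_n, i < j -> j < k -> s i < s j -> s j < s k -> False.

Lemma avoids123P (n : nat) (s : 'S_n) :
  reflect (increasing_triple_free s) (avoids s pat123).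
Proof.
apply: (iffP negP) => [H i j k ij jk sij sjk|H /existsP[f /andP[]]].
  apply: H; apply/existsP.
  exists [ffun x : 'I_3 => tnth [tuple i; j; k] x].
  have ik := ltn_trans ij jk; have sik := ltn_trans sij sjk.
  apply/andP; split; apply/forallP => x; apply/forallP => y;
    rewrite !ffunE ?permE;
    case: x => [[|[|[|//]]] ?]; case: y => [[|[|[|//]]] ?] //=;
    rewrite !(tnth_nth i) /= ?ltnn //; do ?[by rewrite ?ij ?jk ?ik ?sij ?sjk ?sik];
    by rewrite ltnNge ltnW.
move=> /forallP f_incr /forallP sf.
pose o0 : 'I_3 := inord 0; pose o1 : 'I_3 := inord 1; pose o2 : 'I_3 := inord 2.
have incr (a b : 'I_3) : a < b -> f a < f b.
  by move=> ab; move: (f_incr a) => /forallP/(_ b); rewrite ab.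
have sincr (a b : 'I_3) : a < b -> s (f a) < s (f b).
  by move=> ab; move: (sf a) => /forallP/(_ b)/eqP ->; rewrite !permE.
by apply: (H (f o0) (f o1) (f o2)); rewrite ?incr ?sincr ?inordK.
Qed.

(** * Insertion of a new maximum *)

Lemma ltn_lift (n : nat) (p : 'I_n.+1) (i j : 'I_n) :
  (lift p i < lift p j) = (i < j).
Proof. by rewrite /= /bump; lia. Qed.

Section InsertMax.

Variables (n : nat) (s : 'S_n) (p : 'I_n.+1).

(** In one-line notation, this is [s] with the new maximum inserted after its first [p] entries. *)
Local Notation t := (lift_perm p ord_max s).

Lemma insert_max_lift (i : 'I_n) : t (lift p i) = s i :> nat.
Proof. by rewrite lift_perm_lift lift_max. Qed.

Lemma insert_max_id : t p = n :> nat.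
Proof. by rewrite lift_perm_id. Qed.

Lemma insert_max_le (i : 'I_n.+1) : t i <= n.
Proof. exact: leq_ord. Qed.

(** A maximum can only play the 3 of a 123 pattern, so it creates one exactly when two of the [p]
    entries before it increase. *)
Lemma avoids123_insert_max :
  avoids t pat123 = avoids s pat123 && (p <= run s).
Proof.
rewrite leq_run leq_ord /=.
apply/avoids123P/andP => [H|[/avoids123P H /prefix_decreasingP dec]].
  split; first apply/avoids123P => i j k ij jk sij sjk.
    by apply: (H (lift p i) (lift p j) (lift p k));
      rewrite ?ltn_lift ?insert_max_lift.
  apply/prefix_decreasingP => i j ij jp; rewrite ltnNge; apply/negP => le_s.
  apply: (H (lift p i) (lift p j) p);
    rewrite ?ltn_lift ?insert_max_lift ?insert_max_id //.
    by rewrite /= /bump; lia.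
  rewrite ltn_neqAle le_s andbT; apply/eqP => /val_inj/perm_inj eij.
  by rewrite eij ltnn in ij.
move=> i j k ij jk sij sjk.
case: (unliftP p i) => [i'|] ei; last first.
  by rewrite ei insert_max_id ltnNge insert_max_le in sij.
case: (unliftP p j) => [j'|] ej; last first.
  by rewrite ej insert_max_id ltnNge insert_max_le in sjk.
move: ij jk sij sjk; rewrite ei ej ltn_lift !insert_max_lift => ij jk sij.
case: (unliftP p k) jk => [k'|] ->.
  by rewrite ltn_lift insert_max_lift => jk; apply: H sij.
move=> jp _.
have lt_jp : j' < p by move: jp; rewrite /= /bump; lia.
by have := ltn_trans sij (dec _ _ ij lt_jp); rewrite ltnn.
Qed.

(** A maximum placed first lengthens the run by one; placed later, it exceeds its left neighbour and
    so ends the run. *)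
Lemma run_insert_max : p <= run s ->
  run t = if p == 0 :> nat then (run s).+1 else p.
Proof.
rewrite leq_run => /andP[_ dec_p]; apply: eq_from_leq => m.
rewrite leq_run; case: eqP => p0.
  case: m => [|m]; first by rewrite prefix_decreasing0.
  rewrite !ltnS leq_run; congr (_ && _).
  apply/prefix_decreasingP/prefix_decreasingP => dec i j ij jm.
    rewrite -!insert_max_lift; apply: dec; rewrite ?ltn_lift //.
    by rewrite /= /bump; lia.
  case: (unliftP p j) => [j'|] ej; last by move: ij; rewrite ej; lia.
  have {}jm : j' < m by move: jm; rewrite ej /= /bump; lia.
  case: (unliftP p i) => [i'|] ei; rewrite ei ej insert_max_lift.
    by rewrite insert_max_lift; apply: dec => //; rewrite ei ej ltn_lift in ij.
  by rewrite insert_max_id.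
have [le_mp|lt_pm] := leqP m p.
  rewrite (leqW (leq_trans le_mp (leq_ord p))) /=.
  apply/prefix_decreasingP => i j ij jm.
  have ltjp : j < p by apply: leq_trans le_mp.
  case: (unliftP p j) => [j'|] ej; last by rewrite ej ltnn in ltjp.
  case: (unliftP p i) => [i'|] ei; last by rewrite ei in ij; lia.
  rewrite ei ej !insert_max_lift; move/prefix_decreasingP: dec_p; apply.
    by rewrite ei ej ltn_lift in ij.
  by move: ltjp; rewrite ej /= /bump; lia.
apply/negP => /andP[_ /prefix_decreasingP dec].
have lt_q : p.-1 < n.+1 by have := ltn_ord p; lia.
have lt_qp : Ordinal lt_q < p by rewrite /=; lia.
by have := dec _ _ lt_qp lt_pm; rewrite insert_max_id ltnNge insert_max_le.
Qed.

End InsertMax.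

(** Insertion is injective: [p] is recovered as the position of the maximum, then [s] by deleting
    it. Both sides having [(n+1)!] elements, it is bijective. *)
Lemma big_insert_max (n : nat) (F : 'S_n.+1 -> nat) :
  \sum_(t : 'S_n.+1) F t =
  \sum_(s : 'S_n) \sum_(p < n.+1) F (lift_perm p ord_max s).
Proof.
rewrite pair_big /=.
rewrite (reindex (fun x : 'S_n * 'I_n.+1 => lift_perm x.2 ord_max x.1)) //.
apply: onW_bij; apply: inj_card_bij.
  move=> [s p] [s' p'] /= e.
  have ep : p = p'.
    by apply: (@perm_inj _ (lift_perm p ord_max s)); rewrite {2}e !lift_perm_id.
  rewrite -{}ep in e *; congr (_, _); apply/permP => i.
  by apply: (@lift_inj _ ord_max); rewrite -!(lift_perm_lift p) e.
by rewrite card_prod card_ord !card_Sn factS mulnC.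
Qed.

(** * Counting 123-avoiders by run length: the numbers B(n, k) *)

Definition run_count (n k : nat) : nat :=
  \sum_(s : 'S_n | avoids s pat123) (run s == k).

Lemma run_count0 : run_count 0 0 = 1.
Proof.
rewrite /run_count (big_pred1 (1%g : 'S_0)); last first.
  move=> s; have -> : s = 1%g by apply/permP => -[].
  by rewrite /= eqxx; apply/avoids123P => -[].
by have := run_le (1%g : 'S_0); case: run.
Qed.

Lemma run_count_gt (n k : nat) : n < k -> run_count n k = 0.
Proof.
move=> lt_nk; apply: big1 => s _.
by case: eqP => // run_k; have := run_le s; lia.
Qed.

Lemma run_countS0 (n : nat) : run_count n.+1 0 = 0.
Proof.
apply: big1 => s _; case: eqP => // run0.
have : 1 <= run s; last by rewrite run0.
by rewrite leq_run; apply/prefix_decreasingP => i [] [].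
Qed.

(** The sites [p = 0, 1, ..., r] give the run lengths [r + 1, 1, ..., r], so each value from 1 to
    [r + 1] occurs once. *)
Lemma sum_run_insert (n r j : nat) : r <= n ->
  \sum_(p < n.+1 | p <= r) ((if p == 0 :> nat then r.+1 else p) == j.+1) =
  (j <= r).
Proof.
move=> le_rn; rewrite big_mkcond big_ord_recl /= eqSS.
under eq_bigr => i _ do rewrite /bump /= add1n eqSS.
have [lt_jr|le_rj] := ltnP j r.
  (* The site 0 has been split off, so index [j] stands for the site [p = j + 1]. *)
  rewrite (bigD1 (Ordinal (leq_trans lt_jr le_rn))) //= eqxx lt_jr big1.
    by rewrite ltnW //; lia.
  move=> i /eqP ne_ij; case: ifP => // _; case: eqP => // eij.
  by case: ne_ij; apply: val_inj.
rewrite big1 => [|i _]; first by rewrite addn0 eqn_leq le_rj.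
by case: ifP => // lt_ir; case: eqP => // eij; lia.
Qed.

Lemma run_countSS_ge (n j : nat) :
  run_count n.+1 j.+1 = \sum_(s : 'S_n | avoids s pat123) (j <= run s).
Proof.
rewrite /run_count big_mkcond big_insert_max [RHS]big_mkcond /=.
apply: eq_bigr => s _; under eq_bigr => p _ do rewrite avoids123_insert_max.
case: ifP => av; last by rewrite big1.
rewrite -(@sum_run_insert n (run s) j (run_le s)) [RHS]big_mkcond.
by apply: eq_bigr => p _ /=; case: ifP => // /run_insert_max ->.
Qed.

(** Consecutive tail sums differ by the avoiders with run exactly [j]. In series, this is
    [u = u^2 + x] multiplied by [u^j]. *)
Lemma run_countSS (n j : nat) :
  run_count n.+1 j.+1 = run_count n.+1 j.+2 + run_count n j.
Proof.
rewrite !run_countSS_ge -big_split; apply: eq_bigr => s _ /=; lia.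
Qed.

Lemma desarr_count_run (n N : nat) : 0 < n -> n < N ->
  desarr_count n [:: pat123] = \sum_(k < N | ~~ odd k) run_count n k.
Proof.
move=> n_gt0 lt_nN; rewrite /run_count exchange_big /=.
rewrite /desarr_count -sum1dep_card big_mkcondl /=.
rewrite (eq_bigl (fun s : 'S_n => avoids s pat123)); last by move=> s; rewrite andbT.
apply: eq_bigr => s _.
have lt_run : run s < N by apply: leq_ltn_trans (run_le s) lt_nN.
rewrite /desarrangement first_ascentE // big_mkcond (bigD1 (Ordinal lt_run)) //=.
rewrite eqxx big1 ?addn0; first by case: odd.
move=> i /eqP ne_i; case: ifP => // _; case: eqP => // e.
by case: ne_i; apply: val_inj.
Qed.

(* [u * u^k = u^(k+1)]: both sides satisfy the recurrence [run_countSS], which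
   determines them by increasing n and, since they vanish for k >= n,
   by decreasing k. *)
Lemma conv_run_count (n k : nat) :
  \sum_(i < n.+1) run_count i 1 * run_count (n - i) k = run_count n k.+1.
Proof.
elim: n k => [|n IH] k.
  rewrite big_ord1; rewrite (@run_count_gt 0 1) // (@run_count_gt 0 k.+1) //.
have [m le_m] : exists m, n.+1 <= k + m by exists n.+1; rewrite leq_addl.
elim: m k le_m => [|m IHm] k le_m.
  rewrite (@run_count_gt _ k.+1) ?big1 //; last by lia.
  case=> -[|i] lt_i _ /=; first by rewrite (@run_count_gt 0 1).
  by rewrite (@run_count_gt _ k) ?muln0 //; lia.
case: k le_m => [|k] le_m.
  (* Since [u^0 = 1], only the last term survives. *)
  rewrite big_ord_recr /= subnn run_count0 muln1 big1 // => i _.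
  by rewrite subSn ?leq_ord // run_countS0 muln0.
rewrite run_countSS -IH -IHm; last by lia.
(* The last terms vanish; in the others [n.+1 - i] is positive, so the recurrence applies
   termwise. *)
rewrite big_ord_recr [in RHS]big_ord_recr /= subnn.
rewrite !(@run_count_gt 0 _.+1) // !muln0 !addn0 -big_split /=.
by apply: eq_bigr => i _; rewrite subSn ?leq_ord // run_countSS mulnDr.
Qed.

(** Both sides count all 123-avoiders of length [n]: each has exactly one avoiding insertion with
    run 1. *)
Lemma sum_run_count (n N : nat) : n < N ->
  \sum_(k < N) run_count n k = run_count n.+1 1.
Proof.
move=> lt_nN; rewrite run_countSS_ge exchange_big /=; apply: eq_bigr => s _.
have lt_run : run s < N by apply: leq_ltn_trans (run_le s) lt_nN.
rewrite (bigD1 (Ordinal lt_run)) //= eqxx big1 //.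
move=> i /eqP ne_i; case: eqP => // e.
by case: ne_i; apply: val_inj.
Qed.

(** The coefficients of E; the one at [n = 0] is 1, as the empty run is even. *)
Definition even_run_count (n : nat) : nat :=
  \sum_(k < n.+1 | ~~ odd k) run_count n k.

Lemma even_run_countE (n N : nat) : n < N ->
  even_run_count n = \sum_(k < N | ~~ odd k) run_count n k.
Proof.
move=> lt_nN; rewrite /even_run_count (big_ord_widen_cond N (fun k => ~~ odd k)) //.
rewrite big_mkcondr /=; apply: eq_bigr => k _; case: ltnP => // lt_nk.
by rewrite run_count_gt.
Qed.

(* [E + u E = sum_k u^k] *)
Lemma conv_even_run_count (n : nat) :
  even_run_count n + \sum_(i < n.+1) run_count i 1 * even_run_count (n - i) =
  run_count n.+1 1.
Proof.
have -> : \sum_(i < n.+1) run_count i 1 * even_run_count (n - i) =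
  \sum_(k < n.+1 | ~~ odd k) run_count n k.+1.
  under eq_bigr => i _.
    rewrite (@even_run_countE _ n.+1) ?big_distrr; last by rewrite ltnS leq_subr.
    over.
  by rewrite exchange_big; apply: eq_bigr => k _; rewrite conv_run_count.
(* Multiplying by [u] turns even powers into odd ones; the bound [n.+2] leaves [n.+1] indices after
   this shift. *)
rewrite -(@sum_run_count n n.+2) // [RHS](bigID (fun k : 'I__ => ~~ odd k)) /=.
rewrite (@even_run_countE n n.+2) //; congr (_ + _).
rewrite [RHS]big_mkcond big_ord_recl /= big_mkcond /=.
by apply: eq_bigr => k _; rewrite /bump add1n /=; case: odd.
Qed.

End RunStatistics.

(** * Identification of the generating series *)

Lemma fps_inv_unique (f g : fps) :
  f 0%N != 0 -> fps_mul f g =1 fps_const 1 -> g =1 fps_inv f.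
Proof.
move=> f0 fg n; elim/ltn_ind: n => n IH.
have := fg n; rewrite /fps_mul big_ord_recl /= subn0 => e.
rewrite fps_invE; have -> : (n == 0%N)%:R = fps_const 1 n :> rat.
  by rewrite /fps_const; case: (n == 0%N).
rewrite -e; under [X in _ - X]eq_bigr => i _.
  rewrite -IH; first over.
  by rewrite ltn_subrL (leq_ltn_trans _ (ltn_ord i)).
by rewrite addrK mulKf.
Qed.

(** The series [u]. *)
Definition run1_fps : fps := fun n => (run_count n 1)%:R.

(** [1 - 2u] has constant term 1 and square [1 - 4(u - u^2) = 1 - 4x], so it is the square root. *)
Lemma sqrt_1m4XE (n : nat) :
  sqrt_1m4X n = fps_const 1 n - 2%:R * run1_fps n.
Proof.
symmetry; move: n; apply: fps_sqrt_unique.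
  by rewrite /fps_const /run1_fps /= run_count_gt // mulr0 subr0.
have r0 : run1_fps 0%N = 0 by rewrite /run1_fps run_count_gt.
case=> [|n].
  by rewrite /fps_mul /fps_sub !big_ord1 /fps_const /= r0 /fps_X /=; ring.
have conv : \sum_(1 <= i < n.+1) run1_fps i * run1_fps (n.+1 - i)%N =
    (run_count n.+1 2)%:R.
  have := fps_mulSE run1_fps run1_fps n; rewrite r0 mul0r mulr0 addr0 add0r => <-.
  by rewrite -conv_run_count natr_sum; apply: eq_bigr => i _; rewrite natrM.
rewrite fps_mulSE.
rewrite (_ : \sum_(1 <= i < n.+1) _ = 4%:R * (run_count n.+1 2)%:R); last first.
  rewrite -conv mulr_sumr; apply: eq_big_nat => -[//|i] /andP[_ lt_in].
  rewrite /fps_const subn_eq0 leqNgt lt_in /=; ring.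
(* The coefficient of [x] is written through [u^0], to match the last term of [run_countSS]. *)
have -> : fps_sub (fps_const 1) (fps_mul (fps_const 4) fps_X) n.+1 =
    - 4%:R * (run_count n 0)%:R.
  rewrite /fps_sub /fps_mul big_ord_recl /= big1 => [|i _].
    case: n {conv} => [|n]; rewrite /fps_const /fps_X /=.
      by rewrite run_count0; ring.
    by rewrite run_countS0; ring.
  by rewrite /fps_const /= mul0r.
rewrite /fps_const /= r0 /run1_fps run_countSS natrD; ring.
Qed.

(** The series [x E], whose shift yields the index [n.+1] of the Fine number. *)
Definition even_run_fps : fps :=
  fun n => if n is m.+1 then (even_run_count m)%:R else 0.

(** This is [conv_even_run_count] multiplied by [x], with constant term 0 on both sides. *)
Lemma conv_even_run_fps (n : nat) :
  even_run_fps n + fps_mul run1_fps even_run_fps n = run1_fps n.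
Proof.
case: n => [|n]; first by rewrite /fps_mul big_ord1 mulr0 addr0 /run1_fps run_count_gt.
rewrite {2}/run1_fps -conv_even_run_count natrD; congr (_ + _).
rewrite /fps_mul big_ord_recr /= subnn mulr0 addr0 natr_sum.
by apply: eq_bigr => i _; rewrite natrM subSn ?leq_ord.
Qed.

(* With D = 2 + 2u, Fine = 2u / D = 1 - 2 / D, so associativity of the product of
   series is not needed. *)
Lemma FineE : Fine =1 even_run_fps.
Proof.
pose D := fps_sub (fps_const 3%:R) sqrt_1m4X.
have DE i : D i = 2%:R * (fps_const 1 i + run1_fps i).
  rewrite /D /fps_sub sqrt_1m4XE /fps_const; case: eqP => _; ring.
have conv1 f n : fps_mul (fps_const 1) f n = f n.
  rewrite /fps_mul big_ord_recl /= subn0 big1 ?addr0 ?mul1r // => i _.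
  by rewrite /fps_const mul0r.
have convC f n : fps_mul f (fps_const 1) n = f n.
  rewrite /fps_mul big_ord_recr /= subnn big1 ?add0r ?mulr1 // => i _.
  by rewrite /fps_const subn_eq0 leqNgt ltn_ord mulr0.
have D0 : D 0%N != 0.
  by rewrite DE /fps_const /run1_fps /= run_count_gt.
(* [W] is the candidate for [1 / D], found by solving [x E = 1 - 2 / D]. *)
pose W : fps := fun n => (fps_const 1 n - even_run_fps n) / 2%:R.
have DW : fps_mul D W =1 fps_const 1.
  move=> n.
  have -> : fps_mul D W n =
     fps_mul (fps_const 1) (fps_const 1) n + fps_mul run1_fps (fps_const 1) n
      - fps_mul (fps_const 1) even_run_fps n - fps_mul run1_fps even_run_fps n.
    rewrite /fps_mul -big_split -!sumrB; apply: eq_bigr => i _ /=.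
    by rewrite DE /W; field.
  rewrite !conv1 convC -[X in _ + X - _ - _]conv_even_run_fps; ring.
have inv_D := fps_inv_unique D0 DW.
move=> n; rewrite /Fine /fps_div -/D.
have -> : fps_mul (fps_sub (fps_const 1) sqrt_1m4X) (fps_inv D) n =
    fps_mul D W n - 2%:R * fps_mul (fps_const 1) W n.
  rewrite /fps_mul mulr_sumr -sumrB; apply: eq_bigr => i _.
  by rewrite -inv_D DE /fps_sub sqrt_1m4XE; ring.
by rewrite DW conv1 /W; field.
Qed.

Theorem theorem3p9 (n : nat) (hn : (2 <= n)%N) :
  (desarr_count n [:: pat123])%:R = Fine n.+1 :> rat.
Proof.
rewrite FineE /= (@desarr_count_run n n.+1) //.
exact: leq_trans hn.
Qed.
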